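(* Let $T\ge 1$ be an integer, $0<c_1\le c_2$ real numbers, $\{R_k\}_{k\in N_T}$ a sequence of real symmetric positive definite $n\times n$ matrices, and for $k\in N_{T-1}$ let $A_k,C_k\in\mathbb{R}^{n\times n}$ and $B_k,D_k\in\mathbb{R}^{n\times m}$. Suppose there exist symmetric matrices $X_i\in\mathbb{R}^{n\times n}$ ($i\in N_T$), matrices $Y_j\in\mathbb{R}^{m\times n}$ ($j\in N_{T-1}$), and scalars $\alpha\ge 0$, $\hat\lambda_1>0$, $\hat\lambda_2>0$ with $\hat\lambda_1\ge\hat\lambda_2$, such that for all $i\in N_T$ and $j\in N_{T-1}$ $$\hat\lambda_2R_i^{-1}\le X_i\le\hat\lambda_1R_i^{-1},$$ $$(\alpha+1)^Tc_1\hat\lambda_1-c_2\hat\lambda_2<0,$$ $$\begin{bmatrix}-(\alpha+1)X_j&(A_jX_j+B_jY_j)'&(C_jX_j+D_jY_j)'\\ *&-X_{j+1}&0\\ *&*&-X_{j+1}\end{bmatrix}<0.$$ Then the control system $x_{k+1}=A_kx_k+B_ku_k+(C_kx_k+D_ku_k)w_k$, $x_0\in\mathbb{R}^n$, $k\in N_{T-1}$, is finite-time stabilizable with respect to $(c_1,c_2,T,\{R_k\}_{k\in N_T})$ via a linear state feedback $u_k=K_kx_k$, and the gains may be taken to be $K_j=Y_jX_j^{-1}$, $j\in N_{T-1}$.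
   Context: $N_T:=\{0,1,\dots,T\}$. $M'$ is the transpose; for symmetric matrices $M<0$ means negative definite and $M\le N$ means $N-M$ is positive semidefinite; $*$ denotes blocks determined by symmetry. $\|x\|_R^2:=x'Rx$. $\{w_k\}_{k\in N_{T-1}}$ is a sequence of independent real random variables on a complete probability space with $E[w_k]=0$ and $E[w_kw_j]=\delta_{kj}$ (Kronecker delta); $x_0$ is deterministic; $u_k\in\mathbb{R}^m$ is the control input. Finite-time stability: a system $x_{k+1}=F_kx_k+G_kx_kw_k$, $k\in N_{T-1}$, is finite-time stable with respect to $(c_1,c_2,T,\{R_k\}_{k\in N_T})$ if for every deterministic $x_0\in\mathbb{R}^n$, $\|x_0\|_{R_0}^2\le c_1$ implies $E\|x_k\|_{R_k}^2<c_2$ for all $k\in N_T$. Finite-time stabilizability: the control system is finite-time stabilizable with respect to $(c_1,c_2,T,\{R_k\}_{k\in N_T})$ if there is a linear state feedback $u_k=K_kx_k$, $k\in N_{T-1}$, such that the closed-loop system $x_{k+1}=(A_k+B_kK_k)x_k+(C_k+D_kK_k)x_kw_k$ is finite-time stable with respect to $(c_1,c_2,T,\{R_k\}_{k\in N_T})$. *)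

(* Defs.v *)
From HB Require Import structures.
From mathcomp Require Import all_boot all_order all_algebra finmap.
From mathcomp Require Import all_classical all_reals all_analysis.

Set Implicit Arguments.
Unset Strict Implicit.
Unset Printing Implicit Defensive.

Import Order.TTheory GRing.Theory Num.Theory.

Local Open Scope classical_set_scope.
Local Open Scope ring_scope.

Section Definiteness.
Context {R : realType} {n : nat}.
Implicit Types M N : 'M[R]_n.

(* x' M x; for M = R_k this is the weighted norm ||x||_{R_k}^2 *)
Definition qform M (x : 'cV[R]_n) : R := (x^T *m M *m x) 0 0.

Definition posdef_mx M : Prop :=
  M \is symmetricmx /\ forall x : 'cV[R]_n, x != 0 -> 0 < qform M x.

Definition possemidef_mx M : Prop :=
  M \is symmetricmx /\ forall x : 'cV[R]_n, 0 <= qform M x.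

Definition negdef_mx M : Prop :=
  M \is symmetricmx /\ forall x : 'cV[R]_n, x != 0 -> qform M x < 0.

Definition loewner_le M N : Prop := possemidef_mx (N - M).

End Definiteness.

Section StochasticSystem.
Context {d : measure_display} {Omega : measurableType d} {R : realType}
  (P : probability Omega R).

(* Mutual independence of the family (w_k) for k in D: the product rule on
   every finite subfamily. *)
Definition mutually_independent (I : choiceType) (D : set I)
    (w : I -> {RV P >-> R}) : Prop :=
  forall J : {fset I}, [set` J] `<=` D ->
  forall B : I -> set R, (forall k, measurable (B k)) ->
    P (\bigcap_(k in [set` J]) (w k @^-1` B k)) =
    (\prod_(k <- J) P (w k @^-1` B k))%E.

(* Processes, noises and matrix families over a finite horizon are indexed by
   all of nat; x_k only depends on the data at indices below k. *)
Fixpoint trajectory n (F G : nat -> 'M[R]_n) (w : nat -> {RV P >-> R})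
    (x0 : 'cV[R]_n) (k : nat) (omega : Omega) : 'cV[R]_n :=
  if k is j.+1 then
    let xj := trajectory F G w x0 j omega in
    F j *m xj + w j omega *: (G j *m xj)
  else x0.

Definition finite_time_stable n (w : nat -> {RV P >-> R})
    (F G : nat -> 'M[R]_n) (c1 c2 : R) (T : nat) (Rw : nat -> 'M[R]_n) : Prop :=
  forall x0 : 'cV[R]_n, qform (Rw 0%N) x0 <= c1 ->
  forall k, (k <= T)%N ->
    ('E_P[fun omega => qform (Rw k) (trajectory F G w x0 k omega)] < c2%:E)%E.

(* Closed loop of x_{k+1} = A_k x_k + B_k u_k + (C_k x_k + D_k u_k) w_k
   under u_k = K_k x_k. *)
Definition closed_loop_finite_time_stable n m (w : nat -> {RV P >-> R})
    (A C : nat -> 'M[R]_n) (B D : nat -> 'M[R]_(n, m))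
    (K : nat -> 'M[R]_(m, n)) (c1 c2 : R) (T : nat)
    (Rw : nat -> 'M[R]_n) : Prop :=
  finite_time_stable w (fun k => A k + B k *m K k) (fun k => C k + D k *m K k)
    c1 c2 T Rw.

Definition finite_time_stabilizable n m (w : nat -> {RV P >-> R})
    (A C : nat -> 'M[R]_n) (B D : nat -> 'M[R]_(n, m)) (c1 c2 : R) (T : nat)
    (Rw : nat -> 'M[R]_n) : Prop :=
  exists K : nat -> 'M[R]_(m, n),
    closed_loop_finite_time_stable w A C B D K c1 c2 T Rw.

End StochasticSystem.

Definition lmi_mx {R : realType} {n m : nat} (alpha : R)
    (A C : 'M[R]_n) (B D : 'M[R]_(n, m)) (X Xnext : 'M[R]_n)
    (Y : 'M[R]_(m, n)) : 'M[R]_(n + (n + n)) :=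
  let M := A *m X + B *m Y in
  let N := C *m X + D *m Y in
  block_mx (- ((alpha + 1) *: X)) (row_mx M^T N^T)
           (col_mx M N)           (block_mx (- Xnext) 0 0 (- Xnext)).

(* Main.v *)
Require Import Defs.
From HB Require Import structures.
From mathcomp Require Import all_boot all_order all_algebra finmap.
From mathcomp Require Import all_classical all_reals all_analysis.
From mathcomp Require Import measurable_realfun ring lra.

(** A quadratic Lyapunov function decreases in mean, up to the factor
    [alpha + 1], along the closed loop; the two-sided bounds on [X] convert
    this into a bound on the weighted norms.

    Write [F_k], [G_k] for the closed-loop matrices and [V_k] for the inverse
    of [X_k].  Testing the matrix inequality on the vector with blocks
    [V_j x], [V_(j+1) F_j x], [V_(j+1) G_j x], which is what a Schur complement
    amounts to, gives [lmi_decrease]: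
      [F_j' V_(j+1) F_j + G_j' V_(j+1) G_j <= (alpha + 1) V_j].
    Applied to [x_j], the left-hand side has the same expectation as
    [x_(j+1)' V_(j+1) x_(j+1)], because [w_j] has mean 0 and variance 1 and is
    independent of [x_j] ([second_moment_step]).  Hence
      [E(x_k' V_k x_k) <= (alpha + 1)^k x_0' V_0 x_0].
    Inversion reverses the Loewner order ([qform_invmx_le]), so the bounds on
    [X_k] say that [R_k / lambda1 <= V_k <= R_k / lambda2], whence
      [E(x_k' R_k x_k) <= (lambda1 / lambda2) (alpha + 1)^T c1 < c2].

    The probabilistic content is the passage from independence of the noises
    to the factorisation of expectations.  Events determined by
    [w_0, ..., w_(k-1)] form the sigma-algebra generated by the rectangles
    [/\_(i < k) (w_i \in B_i)], which are stable under intersection, so the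
    product rule with events of [w_k] extends from rectangles to the whole
    sigma-algebra ([noise_independent_past]).  For two independent real
    functions the law of the pair is the product of the laws, and Fubini's
    theorem gives [E(XY) = E(X) E(Y)] ([independent_mul]).  Quadratic forms of
    [x_k] are measurable for this sigma-algebra and integrable; proving this
    for all matrices [M] at once makes the induction on [k] close without
    coordinates, since [x_(k+1)' M x_(k+1)] is a combination of three quadratic
    forms of [x_k] with coefficients [1], [w_k] and [w_k^2]. *)

Set Implicit Arguments.
Unset Strict Implicit.
Unset Printing Implicit Defensive.

Import Order.TTheory GRing.Theory Num.Theory.

Local Open Scope classical_set_scope.
Local Open Scope ring_scope.

(** * Quadratic forms and the Loewner order *)

Section QuadraticForms.
Context {R : realType} {n : nat}.
Implicit Types (M N S U : 'M[R]_n) (x y : 'cV[R]_n).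

Lemma symmetricmxP M : reflect (M^T = M) (M \is symmetricmx).
Proof.
by apply: (iffP (is_hermitianmxP _ _ _)); rewrite expr0 scale1r map_mx_id.
Qed.

Lemma qformD M N x : qform (M + N) x = qform M x + qform N x.
Proof. by rewrite /qform mulmxDr mulmxDl mxE. Qed.

Lemma qformZ a M x : qform (a *: M) x = a * qform M x.
Proof. by rewrite /qform -scalemxAr -scalemxAl mxE. Qed.

Lemma qformN M x : qform (- M) x = - qform M x.
Proof. by rewrite /qform mulmxN mulNmx mxE. Qed.

Lemma loewner_le_qform M N x : loewner_le M N -> qform M x <= qform N x.
Proof. by case=> _ /(_ x); rewrite qformD qformN subr_ge0. Qed.

(** Both sides are 1 x 1 matrices, hence equal to their transposes. *)
Lemma mulmx_tr_swap p q (M : 'M[R]_(p, q)) (u : 'cV[R]_p) (v : 'cV[R]_q) :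
  u^T *m M *m v = v^T *m M^T *m u.
Proof.
transitivity ((u^T *m M *m v)^T); last by rewrite !trmx_mul trmxK mulmxA.
by apply/matrixP => i j; rewrite [RHS]mxE !ord1.
Qed.

Lemma qform_mulmx p (M : 'M[R]_p) (F : 'M[R]_(p, n)) x :
  qform M (F *m x) = qform (F^T *m M *m F) x.
Proof. by rewrite /qform trmx_mul !mulmxA. Qed.

Lemma qform_affine M (F G : 'M[R]_n) x a :
  qform M (F *m x + a *: (G *m x)) =
  qform (F^T *m M *m F) x + a * qform (F^T *m M *m G + G^T *m M *m F) x +
  a ^+ 2 * qform (G^T *m M *m G) x.
Proof.
rewrite !qformD -!qform_mulmx /qform.
have bilinear (H L : 'M[R]_n) :
    (x^T *m (H^T *m M *m L) *m x) 0 0 = ((H *m x)^T *m M *m (L *m x)) 0 0.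
  by rewrite trmx_mul !mulmxA.
rewrite !bilinear.
rewrite [(_ + _)^T]linearD /= [(a *: _)^T]linearZ /=.
rewrite !(mulmxDl, mulmxDr).
rewrite -!(scalemxAl, scalemxAr) !mxE; ring.
Qed.

Lemma posdef_mx_unit M : posdef_mx M -> M \in unitmx.
Proof.
case=> _ posM; rewrite -row_free_unit -kermx_eq0; apply/eqP/row_matrixP => i.
set v := row i _; have /sub_kermxP vM0 : (v <= kermx M)%MS by exact: row_sub.
rewrite row0; apply/eqP; apply: contraT => v0.
have := posM v^T; rewrite /qform trmxK vM0 mul0mx mxE ltxx; apply.
by rewrite -(trmx0 R) (inj_eq trmx_inj).
Qed.

Lemma tr_invmx_sym M : M \is symmetricmx -> (invmx M)^T = invmx M.
Proof. by move=> /symmetricmxP MT; rewrite trmx_inv MT. Qed.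

Lemma qform_invmx M x : M \is symmetricmx -> M \in unitmx ->
  qform M (invmx M *m x) = qform (invmx M) x.
Proof.
by move=> sM uM; rewrite qform_mulmx tr_invmx_sym// mulVmx// mul1mx.
Qed.

Lemma posdef_invmx M : posdef_mx M -> posdef_mx (invmx M).
Proof.
move=> pM; have [sM posM] := pM; have uM := posdef_mx_unit pM.
split=> [|x x0]; first by apply/symmetricmxP; exact: tr_invmx_sym.
rewrite -qform_invmx//; apply: posM; apply: contra_neq x0 => Mx0.
by rewrite -(mulKVmx uM x) Mx0 mulmx0.
Qed.

Lemma posdefZ a M : 0 < a -> posdef_mx M -> posdef_mx (a *: M).
Proof.
move=> a0 [/symmetricmxP sM pM]; split=> [|x x0].
  by apply/symmetricmxP; rewrite linearZ /= sM.
by rewrite qformZ mulr_gt0// pM.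
Qed.

Lemma posdef_loewner_le U S : S \is symmetricmx -> posdef_mx U ->
  loewner_le U S -> posdef_mx S.
Proof.
move=> sS [_ pU] US; split=> // x x0.
exact: lt_le_trans (pU _ x0) (loewner_le_qform _ US).
Qed.

(** Since the left-hand side is nonnegative, this shows that [x' U^-1 x] is the
    maximum over [y] of [2 y'x - y'Uy], attained at [y = U^-1 x]. *)
Lemma qform_complete_square U y x : posdef_mx U ->
  qform U (y - invmx U *m x) =
  qform U y - 2 * (y^T *m x) 0 0 + qform (invmx U) x.
Proof.
move=> pU; have [sU _] := pU; have uU := posdef_mx_unit pU.
have xy : x^T *m y = y^T *m x.
  by have := mulmx_tr_swap 1%:M x y; rewrite trmx1 !mulmx1.
rewrite {1}/qform [(_ - _)^T]linearB /= trmx_mul (tr_invmx_sym sU).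
rewrite !(mulmxBl, mulmxBr).
rewrite !mulmxA mulmxKV// mulmxK//.
rewrite xy /qform !mxE; ring.
Qed.

(** By the variational formula for the inverse, [x' U^-1 x] bounds
    [2 y'x - y'Uy >= 2 y'x - y'Sy] for every [y]; at [y = S^-1 x] the latter is
    [x' S^-1 x]. *)
Lemma qform_invmx_le U S x : posdef_mx U -> posdef_mx S ->
  loewner_le U S -> qform (invmx S) x <= qform (invmx U) x.
Proof.
move=> pU pS US; pose y := invmx S *m x.
have [sS _] := pS; have uS := posdef_mx_unit pS.
have yx : (y^T *m x) 0 0 = qform (invmx S) x.
  by rewrite /y trmx_mul tr_invmx_sym.
have yS : qform S y = qform (invmx S) x by rewrite qform_invmx.
have : 0 <= qform U (y - invmx U *m x).
  have [->|y0] := eqVneq (y - invmx U *m x) 0.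
    by rewrite /qform mulmx0 mxE.
  by apply: ltW; apply pU.2.
rewrite qform_complete_square// yx.
have := loewner_le_qform y US; rewrite yS; lra.
Qed.

Lemma invmxZ_invmx (a : R) M : a != 0 -> posdef_mx M ->
  invmx (a *: invmx M) = a^-1 *: M.
Proof.
move=> a0 pM; have uM := posdef_mx_unit pM.
rewrite invmxZ ?invmxK// unitmxZ ?unitfE// unitmx_inv//.
Qed.

End QuadraticForms.

Lemma qform_lmi_mx (R : realType) (n m : nat) (alpha : R)
    (A C : 'M[R]_n) (B D : 'M[R]_(n, m)) (X Xnext : 'M[R]_n)
    (Y : 'M[R]_(m, n)) (u p q : 'cV[R]_n) :
  qform (lmi_mx alpha A C B D X Xnext Y) (col_mx u (col_mx p q)) =
  - ((alpha + 1) * qform X u) + 2 * (p^T *m (A *m X + B *m Y) *m u) 0 0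
  + 2 * (q^T *m (C *m X + D *m Y) *m u) 0 0 - qform Xnext p - qform Xnext q.
Proof.
rewrite /lmi_mx; set M := _ *m _ + _; set N := _ *m _ + _.
rewrite /qform !tr_col_mx !mul_row_block !mul_row_col mul_mx_row.
rewrite !mulmx0 addr0 add0r [(row_mx _ _ + _) *m _]mulmxDl.
rewrite !mul_row_col !mulmxDl !mulmxN !mulNmx -scalemxAr -scalemxAl.
rewrite -(mulmx_tr_swap M p u) -(mulmx_tr_swap N q u) !mxE; ring.
Qed.

(** The Schur complement, one vector at a time.  For fixed [u], the quadratic
    form of the block matrix is concave in the two lower blocks [p] and [q];
    its maximum is reached at [p = Xnext^-1 (A X + B Y) u] and
    [q = Xnext^-1 (C X + D Y) u].  Taking [u = X^-1 x] turns the parameter [Y]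
    back into the gain [Y X^-1]. *)
Lemma lmi_decrease (R : realType) (n m : nat) (alpha : R)
    (A C : 'M[R]_n) (B D : 'M[R]_(n, m)) (X Xnext : 'M[R]_n)
    (Y : 'M[R]_(m, n)) (x : 'cV[R]_n) :
  let F := A + B *m (Y *m invmx X) in let G := C + D *m (Y *m invmx X) in
  posdef_mx X -> posdef_mx Xnext ->
  negdef_mx (lmi_mx alpha A C B D X Xnext Y) ->
  qform (F^T *m invmx Xnext *m F + G^T *m invmx Xnext *m G) x <=
  (alpha + 1) * qform (invmx X) x.
Proof.
move=> F G pX pX' [_ neg].
have uX := posdef_mx_unit pX; have uX' := posdef_mx_unit pX'.
have [sX _] := pX; have [sX' _] := pX'.
pose u := invmx X *m x.
pose p := invmx Xnext *m (F *m x); pose q := invmx Xnext *m (G *m x).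
have Fu : (A *m X + B *m Y) *m u = F *m x.
  by rewrite /u /F !mulmxDl !mulmxA mulmxK.
have Gu : (C *m X + D *m Y) *m u = G *m x.
  by rewrite /u /G !mulmxDl !mulmxA mulmxK.
have : qform (lmi_mx alpha A C B D X Xnext Y) (col_mx u (col_mx p q)) <= 0.
  have [->|z0] := eqVneq (col_mx u (col_mx p q)) 0.
    by rewrite /qform mulmx0 mxE.
  exact/ltW/neg.
rewrite qform_lmi_mx -!(mulmxA _^T) Fu Gu /p /q !qform_invmx//.
have dual v : ((invmx Xnext *m v)^T *m v) 0 0 = qform (invmx Xnext) v.
  by rewrite trmx_mul tr_invmx_sym.
rewrite !dual qformD !mulmxA -!qform_mulmx; lra.
Qed.

(** * Expectation of a product of independent functions *)

Section ProductOfIndependent.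
Context {d : measure_display} {Omega : measurableType d} {R : realType}
  (P : probability Omega R).
Local Open Scope ereal_scope.

Definition independent_functions (X Y : Omega -> R) : Prop :=
  forall A B : set R, measurable A -> measurable B ->
    P (X @^-1` A `&` Y @^-1` B) = P (X @^-1` A) * P (Y @^-1` B).

(** Independence says that the law of [(X, Y)] and the product of the two laws
    agree on rectangles, hence everywhere.  Tonelli's theorem then makes the
    product integrable, and Fubini's theorem computes its integral. *)
Lemma independent_mul (X Y : Omega -> R) :
  P.-integrable setT (EFin \o X) -> P.-integrable setT (EFin \o Y) ->
  independent_functions X Y ->
  P.-integrable setT (EFin \o (X \* Y)%R) /\
  \int[P]_t (X t * Y t)%:E = \int[P]_t (X t)%:E * \int[P]_t (Y t)%:E.
Proof.
move=> iX iY indep.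
have mX : measurable_fun setT X by apply/measurable_EFinP; exact: measurable_int iX.
have mY : measurable_fun setT Y by apply/measurable_EFinP; exact: measurable_int iY.
have mXY : measurable_fun setT (fun t => (X t, Y t)) by exact: measurable_fun_pair.
pose X' : {mfun Omega >-> R} := HB.pack X (isMeasurableFun.Build _ _ _ _ _ mX).
pose Y' : {mfun Omega >-> R} := HB.pack Y (isMeasurableFun.Build _ _ _ _ _ mY).
pose Z' : {mfun Omega >-> (R * R)%type} :=
  HB.pack (fun t => (X t, Y t)) (isMeasurableFun.Build _ _ _ _ _ mXY).
pose muX := distribution P X'; pose muY := distribution P Y'.
pose muXY := distribution P Z'.
have joint A : measurable A -> (muX \x muY) A = muXY A.
  by apply: product_measure_unique => B C mB mC; exact: indep.
pose f (z : R * R) : \bar R := (z.1 * z.2)%:E.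
have mf : measurable_fun setT f.
  by apply/measurable_EFinP; exact: measurable_funM.
have transfer (g : R * R -> \bar R) : \int[muX \x muY]_z g z = \int[muXY]_z g z.
  by apply: eq_measure_integral => A mA _; exact: joint.
have iX' : muX.-integrable setT EFin by exact: integrable_pushforward.
have iY' : muY.-integrable setT EFin by exact: integrable_pushforward.
have mabs : measurable_fun setT (fun x : R => `|x|%:E).
  by apply/measurable_EFinP; exact: normr_measurable.
have iprod : (muX \x muY).-integrable setT f.
  apply/integrable12ltyP => //.
  have inner x : \int[muY]_y `|f (x, y)| = `|x|%:E * \int[muY]_y `|y|%:E.
    rewrite -ge0_integralZl//.
    by apply: eq_integral => y _; rewrite /f /= normrM EFinM.
  under eq_integral do rewrite inner.
  rewrite ge0_integralZr//; last exact: integral_ge0.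
  move/integrableP: iX' => [_ fX]; move/integrableP: iY' => [_ fY].
  by apply: lte_mul_pinfty; rewrite ?ge0_fin_numE//; exact: integral_ge0.
have iXY : muXY.-integrable setT f.
  move/integrableP: iprod => [_ fin].
  by apply/integrableP; split=> //; rewrite -transfer.
have ifZ : P.-integrable setT (f \o Z').
  apply/integrableP; split; first by apply/measurable_EFinP; exact: measurable_funM.
  move/integrableP: iXY => [_].
  by rewrite ge0_integral_distribution//; exact: measurableT_comp.
split; first by [].
transitivity (\int[muXY]_z f z); first by rewrite integral_distribution.
rewrite -transfer -integral12_prod_meas1//= /fubini_F.
have inner x : \int[muY]_y f (x, y) = x%:E * \int[muY]_y y%:E.
  by rewrite -integralZl.
under eq_integral do rewrite inner.
have EX : \int[muX]_x x%:E = \int[P]_t (X t)%:E by rewrite integral_distribution.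
have EY : \int[muY]_y y%:E = \int[P]_t (Y t)%:E by rewrite integral_distribution.
have finY : \int[P]_t (Y t)%:E \is a fin_num by exact: integrable_fin_num.
by rewrite EY -(fineK finY) integralZr// EX.
Qed.

End ProductOfIndependent.

(** * Independence of a noise from the past *)

Section History.
Context {d : measure_display} {Omega : measurableType d} {R : realType}
  (P : probability Omega R) (w : nat -> {RV P >-> R}).

(** A generating family stable under intersection for the events determined by
    [w_0, ..., w_(k-1)]. *)
Definition past_rectangles (k : nat) : set (set Omega) :=
  [set S | exists2 B : nat -> set R, (forall i, measurable (B i)) &
    S = \bigcap_(i in `I_k) (w i @^-1` B i)].

(** The sample space with the sigma-algebra of the past, so that a function is
    adapted at time [k] exactly when it is measurable from [past k]. *)
Definition past (k : nat) := g_sigma_algebraType (past_rectangles k).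

Lemma past_rectangles_measurable k : past_rectangles k `<=` measurable.
Proof.
move=> _ [B mB ->]; apply: fin_bigcap_measurable => // i _.
exact: measurable_sfunP.
Qed.

Lemma past_rectanglesT k : past_rectangles k setT.
Proof. by exists (fun=> setT) => //; rewrite bigcapT. Qed.

Lemma past_rectanglesI k : setI_closed (past_rectangles k).
Proof.
move=> _ _ [B mB ->] [C mC ->]; exists (fun i => B i `&` C i).
  by move=> i; exact: measurableI.
by rewrite -bigcapI.
Qed.

Lemma past_rectangles_mono k l : (k <= l)%N ->
  past_rectangles k `<=` past_rectangles l.
Proof.
move=> kl _ [B mB ->]; exists (fun i => if (i < k)%N then B i else setT).
  by move=> i; case: ifP.
apply/seteqP; split=> t /= Bt i /= ik.
  by case: ifP => // ik'; exact: Bt.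
by have := Bt i (leq_trans ik kl); rewrite ik.
Qed.

Lemma noise_past k : measurable_fun setT (w k : past k.+1 -> R).
Proof.
move=> _ B mB; rewrite setTI; apply: sub_sigma_algebra.
exists (fun i => if i == k then B else setT); first by move=> i; case: ifP.
apply/seteqP; split=> t /=.
  by move=> Bt i _; case: eqP => [->|].
by move=> /(_ k); rewrite /= eqxx; exact.
Qed.

Lemma past_mono k (f : Omega -> R) :
  measurable_fun setT (f : past k -> R) ->
  measurable_fun setT (f : past k.+1 -> R).
Proof.
move=> mf _ B mB; have := mf measurableT B mB.
apply: sub_smallest2r; first exact: smallest_sigma_algebra.
exact: past_rectangles_mono.
Qed.

(** Fix an event of [w k], of probability [e].  The finite measures
    [S |-> P (S `&` event)] and [S |-> e * P S] agree on rectangles by the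
    product rule, and rectangles are stable under intersection, so they agree
    on all events of the past. *)
Lemma noise_independent_past k (f : Omega -> R) (g : R -> R) (D : set nat) :
  mutually_independent D w -> (forall i, (i <= k)%N -> D i) ->
  measurable_fun setT (f : past k -> R) -> measurable_fun setT g ->
  independent_functions P f (g \o w k).
Proof.
move=> indep kD mf mg A B mA mB.
have {mf mA} pA : <<s past_rectangles k >> (f @^-1` A).
  by have := mf measurableT A mA; rewrite setTI.
pose C := g @^-1` B.
change (P (f @^-1` A `&` w k @^-1` C) = P (f @^-1` A) * P (w k @^-1` C))%E.
have mC : measurable C by rewrite -[C]setTI; exact: mg.
have mE : measurable (w k @^-1` C) by exact: measurable_sfunP.
have finE : P (w k @^-1` C) \is a fin_num by exact: fin_num_measure.
have e0 : 0 <= fine (P (w k @^-1` C)) by rewrite fine_ge0.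
pose m1 := mrestr P mE.
pose m2 := mscale (NngNum e0) P.
suff E S : <<s past_rectangles k >> S -> m1 S = m2 S.
  have := E _ pA; rewrite /m1 /m2 /mrestr /mscale /= fineK// => ->.
  by rewrite muleC.
apply: (g_sigma_algebra_measure_unique (past_rectangles k) _ (fun=> setT)).
- exact: past_rectangles_measurable.
- by move=> _; exact: past_rectanglesT.
- by rewrite bigcup_const.
- exact: past_rectanglesI.
- move=> _ [F mF ->].
  (* Extending the rectangle by the event of [w k] gives a family indexed by
     [0, ..., k], to which the product rule applies; comparing with the product
     rule on [0, ..., k-1] isolates the factor of index [k]. *)
  pose F' i := if i == k then C else F i.
  have mF' i : measurable (F' i) by rewrite /F'; case: ifP.
  pose J := [fset i in iota 0 k]%fset.
  have inJ i : (i \in J) = (i < k)%N by rewrite /J !inE mem_iota.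
  have kJ : k \notin J by rewrite inJ ltnn.
  have eqJ G : \bigcap_(i in `I_k) G i = \bigcap_(i in [set` J]) G i :> set Omega.
    by apply/seteqP; split=> t Gt i /= ik; apply: Gt; rewrite /= ?inJ // -inJ.
  have JD : [set` J] `<=` D by move=> i /=; rewrite inJ => /ltnW; exact: kD.
  have kJD : [set` (k |` J)%fset] `<=` D.
    by move=> i /=; rewrite in_fset1U inJ -leq_eqVlt; exact: kD.
  change (P (\bigcap_(i in `I_k) (w i @^-1` F i) `&` w k @^-1` C) =
    (fine (P (w k @^-1` C)))%:E * P (\bigcap_(i in `I_k) (w i @^-1` F i)))%E.
  have F'k : F' k = C by rewrite /F' eqxx.
  have F'E i : i \in J -> F' i = F i.
    by rewrite inJ /F'; case: eqP => // ->; rewrite ltnn.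
  have := indep _ kJD _ mF'; rewrite big_fsetU1//= bigcap_fsetU1.
  rewrite F'k setIC fineK// eqJ (indep _ JD _ mF) => E1.
  rewrite (_ : \bigcap_(i in [set` J]) _ = \bigcap_(i in [set` J]) (w i @^-1` F' i)).
    rewrite E1; congr (_ * _)%E.
    by apply: eq_big_seq => i iJ; rewrite F'E.
  by apply: eq_bigcapr => i /= iJ; rewrite F'E.
- move=> _; change (P (setT `&` w k @^-1` C) < +oo)%E.
  by rewrite setTI -ge0_fin_numE.
Qed.

End History.

(** * Adding one noise to the past *)

Section OneStep.
Context {d : measure_display} {Omega : measurableType d} {R : realType}
  (P : probability Omega R) (w : nat -> {RV P >-> R}).

Lemma sqr_integrable (X : {RV P >-> R}) (c : R) :
  ('E_P[fun t => (X t * X t)%R] = c%:E)%E ->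
  P.-integrable setT (EFin \o (fun t => X t ^+ 2)).
Proof.
rewrite unlock => EX; apply/integrableP; split.
  by apply/measurable_EFinP; exact: measurable_funX.
rewrite (_ : (\int[P]_t _)%E = c%:E) ?ltry// -EX.
by apply: eq_integral => t _; rewrite /= ger0_norm ?sqr_ge0// expr2.
Qed.

(** The total mass is finite, so [|X| <= 1 + X^2] suffices. *)
Lemma integrable_of_sqr (X : {RV P >-> R}) :
  P.-integrable setT (EFin \o (fun t => X t ^+ 2)) ->
  P.-integrable setT (EFin \o X).
Proof.
move=> iX2.
have i1 : P.-integrable setT (EFin \o (fun t => 1 + X t ^+ 2)).
  have := integrableD measurableT (finite_measure_integrable_cst P 1 measurableT) iX2.
  by apply: eq_integrable.
apply: le_integrable i1 => //; first exact/measurable_EFinP.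
move=> t _; have n1 : 0 <= 1 + X t ^+ 2 by rewrite addr_ge0// sqr_ge0.
rewrite /= lee_fin (ger0_norm n1) -(real_normK (num_real (X t))).
by have := sqr_ge0 (`|X t| - 1); nra.
Qed.

Definition past_integrable (k : nat) (f : Omega -> R) : Prop :=
  measurable_fun setT (f : past w k -> R) /\ P.-integrable setT (EFin \o f).

(** The shape of a quadratic form after one step of the dynamics.  The cross
    term has zero mean because [E (w k) = 0], and the last one keeps its mean
    because [E (w k ^ 2) = 1]; both use that the coefficients belong to the
    past. *)
Lemma past_integrable_step (k : nat) (D : set nat) (f0 f1 f2 : Omega -> R) :
  mutually_independent D w -> (forall i, (i <= k)%N -> D i) ->
  ('E_P[w k] = 0)%E -> ('E_P[fun t => (w k t * w k t)%R] = 1)%E ->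
  past_integrable k f0 -> past_integrable k f1 -> past_integrable k f2 ->
  let h := fun t => f0 t + w k t * f1 t + w k t ^+ 2 * f2 t in
  past_integrable k.+1 h /\
  (\int[P]_t (h t)%:E = \int[P]_t (f0 t)%:E + \int[P]_t (f2 t)%:E)%E.
Proof.
move=> indep kD w0 w1 [m0 i0] [m1 i1] [m2 i2] h.
have iw2 := sqr_integrable w1; have iw := integrable_of_sqr iw2.
have [iwf1 Ewf1] := independent_mul i1 iw
  (noise_independent_past indep kD m1 (@measurable_id _ _ setT)).
have [iwf2 Ewf2] := independent_mul i2 iw2
  (noise_independent_past indep kD m2 (measurable_funX 2 (@measurable_id _ _ setT))).
have hE : EFin \o h = (fun t => (f0 t)%:E + (f1 t * w k t)%:E + (f2 t * w k t ^+ 2)%:E)%E.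
  by apply/funext => t; rewrite /h /= !EFinD mulrC [w k t ^+ 2 * _]mulrC.
have i01 : P.-integrable setT (fun t => (f0 t)%:E + (f1 t * w k t)%:E)%E by exact: integrableD.
split; first split.
- have mw := @noise_past _ _ _ _ w k.
  exact: (measurable_funD
    (measurable_funD (past_mono m0) (measurable_funM mw (past_mono m1)))
    (measurable_funM (measurable_funX 2 mw) (past_mono m2))).
- by rewrite hE; exact: integrableD.
rewrite -[LHS]/(\int[P]_t (EFin \o h) t)%E hE integralD// integralD//.
rewrite unlock in w0 w1.
by rewrite Ewf1 Ewf2 w0 mule0 adde0 w1 mule1.
Qed.

End OneStep.

(** * Second moments along a trajectory *)

Section SecondMoments.
Context {d : measure_display} {Omega : measurableType d} {R : realType}
  (P : probability Omega R) (T : nat) (w : nat -> {RV P >-> R})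
  (w_indep : mutually_independent [set k : nat | (k < T)%N] w)
  (w_mean : forall k, (k < T)%N -> ('E_P[w k] = 0)%E)
  (w_var : forall k, (k < T)%N ->
    ('E_P[fun t => (w k t * w k t)%R] = 1)%E).
Context {n : nat} (F G : nat -> 'M[R]_n) (x0 : 'cV[R]_n).
Local Notation x := (trajectory F G w x0).

Let trajectory_step k M : (k < T)%N ->
    (forall N, past_integrable w k (fun t => qform N (x k t))) ->
  past_integrable w k.+1 (fun t => qform M (x k.+1 t)) /\
  (\int[P]_t (qform M (x k.+1 t))%:E =
   \int[P]_t (qform ((F k)^T *m M *m F k) (x k t))%:E +
   \int[P]_t (qform ((G k)^T *m M *m G k) (x k t))%:E)%E.
Proof.
move=> kT ih; under eq_fun do rewrite /= qform_affine.
under eq_integral do rewrite /= qform_affine.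
apply: past_integrable_step w_indep _ (w_mean kT) (w_var kT) (ih _) (ih _) (ih _).
by move=> i ik; exact: leq_ltn_trans ik kT.
Qed.

(** The induction needs all matrices [M] at once, since one step replaces [M]
    by three other matrices. *)
Lemma qform_trajectory_past_integrable k M : (k <= T)%N ->
  past_integrable w k (fun t => qform M (x k t)).
Proof.
elim: k M => [|k ih] M kT.
  split; first exact: (measurable_cst (qform M x0)).
  exact: (finite_measure_integrable_cst P (qform M x0)).
by apply: (trajectory_step _ kT _).1 => N; exact/ih/ltnW.
Qed.

Lemma qform_trajectory_integrable k M : (k <= T)%N ->
  P.-integrable setT (fun t => (qform M (x k t))%:E).
Proof. by move=> kT; case: (qform_trajectory_past_integrable M kT). Qed.

Lemma second_moment_step k M : (k < T)%N ->
  (\int[P]_t (qform M (x k.+1 t))%:E =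
   \int[P]_t (qform ((F k)^T *m M *m F k + (G k)^T *m M *m G k) (x k t))%:E)%E.
Proof.
move=> kT; under [RHS]eq_integral do rewrite qformD EFinD.
have kT' := ltnW kT.
rewrite integralD//; [|exact: qform_trajectory_integrable..].
by apply: (trajectory_step _ kT _).2 => N; exact: qform_trajectory_past_integrable.
Qed.

(** Discrete Gronwall: [V k] plays the role of a Lyapunov function whose mean
    grows at most by the factor [a] at each step. *)
Lemma second_moment_growth (V : nat -> 'M[R]_n) (a : R) : 0 <= a ->
    (forall k, (k < T)%N -> forall y,
      qform ((F k)^T *m V k.+1 *m F k + (G k)^T *m V k.+1 *m G k) y <=
      a * qform (V k) y) ->
  forall k, (k <= T)%N ->
  (\int[P]_t (qform (V k) (x k t))%:E <= (a ^+ k * qform (V 0%N) x0)%:E)%E.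
Proof.
move=> a0 decr; elim=> [|k ih] kT.
  rewrite expr0 mul1r.
  rewrite -[leLHS]/(\int[P]_t (cst (qform (V 0%N) x0) t)%:E)%E.
  by have := expectation_cst P (qform (V 0%N) x0); rewrite unlock => ->.
have kT' := ltnW kT; have ik := qform_trajectory_integrable (V k) kT'.
rewrite second_moment_step//.
apply: (@le_trans _ _ (\int[P]_t (a%:E * (qform (V k) (x k t))%:E))%E).
  apply: le_integral => //; first exact: qform_trajectory_integrable.
    exact: integrableZl.
  by move=> t _; rewrite -EFinM lee_fin; exact: decr.
by rewrite integralZl// exprS -mulrA EFinM lee_wpmul2l// ?lee_fin// ih.
Qed.

End SecondMoments.

Unset Implicit Arguments.

Theorem theorem5 (R : realType) (d : measure_display)
  (Omega : measurableType d) (P : probability Omega R)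
  (P_complete : measure_is_complete P)
  (T : nat) (T_ge1 : (1 <= T)%N)
  (w : nat -> {RV P >-> R})
  (w_indep : mutually_independent [set k : nat | (k < T)%N] w)
  (w_mean : forall k, (k < T)%N -> ('E_P[w k] = 0)%E)
  (w_cov : forall k j, (k < T)%N -> (j < T)%N ->
     ('E_P[fun omega => (w k omega * w j omega)%R] = (k == j)%:R%:E)%E)
  (n m : nat) (c1 c2 : R) (c1_gt0 : 0 < c1) (c1_le_c2 : c1 <= c2)
  (Rw : nat -> 'M[R]_n)
  (Rw_posdef : forall k, (k <= T)%N -> posdef_mx (Rw k))
  (A C : nat -> 'M[R]_n) (B D : nat -> 'M[R]_(n, m))
  (X : nat -> 'M[R]_n) (Y : nat -> 'M[R]_(m, n))
  (alpha lambda1 lambda2 : R)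
  (X_sym : forall i, (i <= T)%N -> X i \is symmetricmx)
  (alpha_ge0 : 0 <= alpha)
  (lambda1_gt0 : 0 < lambda1) (lambda2_gt0 : 0 < lambda2)
  (lambda2_le_lambda1 : lambda2 <= lambda1)
  (X_bounds : forall i, (i <= T)%N ->
     loewner_le (lambda2 *: invmx (Rw i)) (X i) /\
     loewner_le (X i) (lambda1 *: invmx (Rw i)))
  (scalar_bound : (alpha + 1) ^+ T * c1 * lambda1 - c2 * lambda2 < 0)
  (lmi : forall j, (j < T)%N ->
     negdef_mx (lmi_mx alpha (A j) (C j) (B j) (D j) (X j) (X j.+1) (Y j))) :
  finite_time_stabilizable w A C B D c1 c2 T Rw /\
  closed_loop_finite_time_stable w A C B D (fun j => Y j *m invmx (X j))
    c1 c2 T Rw.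
Proof.
pose V k := invmx (X k); pose K j := Y j *m invmx (X j).
have lower_posdef i : (i <= T)%N -> posdef_mx (lambda2 *: invmx (Rw i)).
  by move=> iT; apply: posdefZ => //; apply: posdef_invmx; exact: Rw_posdef.
have upper_posdef i : (i <= T)%N -> posdef_mx (lambda1 *: invmx (Rw i)).
  by move=> iT; apply: posdefZ => //; apply: posdef_invmx; exact: Rw_posdef.
have X_posdef i : (i <= T)%N -> posdef_mx (X i).
  move=> iT; have [XR _] := X_bounds _ iT.
  exact: posdef_loewner_le (X_sym _ iT) (lower_posdef _ iT) XR.
have V_upper i x : (i <= T)%N -> lambda2 * qform (V i) x <= qform (Rw i) x.
  move=> iT; have [XR _] := X_bounds _ iT.
  have := qform_invmx_le x (lower_posdef _ iT) (X_posdef _ iT) XR.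
  rewrite invmxZ_invmx ?gt_eqF//; last exact: Rw_posdef.
  by rewrite qformZ mulrC ler_pdivlMr// mulrC.
have V_lower i x : (i <= T)%N -> qform (Rw i) x <= lambda1 * qform (V i) x.
  move=> iT; have [_ XR] := X_bounds _ iT.
  have := qform_invmx_le x (X_posdef _ iT) (upper_posdef _ iT) XR.
  rewrite invmxZ_invmx ?gt_eqF//; last exact: Rw_posdef.
  by rewrite qformZ mulrC ler_pdivrMr// mulrC.
suff stable : closed_loop_finite_time_stable w A C B D K c1 c2 T Rw.
  by split=> //; exists K.
move=> x0 x0c1 k kT.
pose F j := A j + B j *m K j; pose G j := C j + D j *m K j.
have w_var j : (j < T)%N -> ('E_P[fun t => (w j t * w j t)%R] = 1)%E.
  by move=> jT; rewrite w_cov// eqxx.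
have a_ge1 : 1 <= alpha + 1 by rewrite lerDr.
have a_ge0 : 0 <= alpha + 1 by exact: le_trans a_ge1.
have decrease j : (j < T)%N -> forall x,
    qform ((F j)^T *m V j.+1 *m F j + (G j)^T *m V j.+1 *m G j) x <=
    (alpha + 1) * qform (V j) x.
  move=> jT x; apply: lmi_decrease (lmi _ jT); apply: X_posdef => //.
  exact: ltnW.
have growth :=
  second_moment_growth w_indep w_mean w_var x0 a_ge0 decrease kT.
have integrable_q M :=
  qform_trajectory_integrable w_indep w_mean w_var F G x0 M kT.
rewrite unlock.
apply: (@le_lt_trans _ _
    (\int[P]_t (lambda1%:E * (qform (V k) (trajectory F G w x0 k t))%:E))%E).
  apply: le_integral => //; first exact: integrableZl.
  by move=> t _; rewrite -EFinM lee_fin; exact: V_lower.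
rewrite integralZl//.
apply: (@le_lt_trans _ _
    (lambda1 * ((alpha + 1) ^+ k * qform (V 0%N) x0))%:E).
  by rewrite EFinM lee_wpmul2l// lee_fin ltW.
rewrite lte_fin -(ltr_pM2r lambda2_gt0).
have initial : lambda2 * qform (V 0%N) x0 <= c1.
  by apply: le_trans x0c1; exact: V_upper.
have powers : (alpha + 1) ^+ k <= (alpha + 1) ^+ T by exact: ler_weXn2l.
apply: (@le_lt_trans _ _ (lambda1 * ((alpha + 1) ^+ T * c1))); last first.
  by move: scalar_bound; rewrite subr_lt0; apply: le_lt_trans; rewrite mulrC.
rewrite -!mulrA ler_pM2l// [_ * lambda2]mulrC.
apply: (@le_trans _ _ ((alpha + 1) ^+ k * c1)).
  by apply: ler_wpM2l => //; exact: exprn_ge0.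
by apply: ler_wpM2r => //; exact: ltW.
Qed.
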